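(* An ordinary topological parallelism $\Pi$ of $\mathrm{PG}(3,\mathbb{R})$ is homeomorphic to the real projective plane. An oriented topological parallelism $\Pi^+$ of $\mathrm{PG}(3,\mathbb{R})$ is homeomorphic to the 2-sphere.
   Context: $\mathcal{L}$ is the space of lines of $\mathrm{PG}(3,\mathbb{R})$ (2-dimensional subspaces of $\mathbb{R}^4$) and $\mathcal{L}^+$ the space of oriented lines (2-dimensional subspaces with a vector space orientation), both topologized as coset spaces of $\mathrm{PGL}(4,\mathbb{R})$; forgetting orientation gives a twofold covering $\mathcal{L}^+\to\mathcal{L}$. A compact spread is a compact set of pairwise disjoint lines covering the point set of $\mathrm{PG}(3,\mathbb{R})$. A compact spread $\mathcal{C}$ is homeomorphic to the 2-sphere, its inverse image in $\mathcal{L}^+$ is a disjoint union of two 2-spheres, each mapped homeomorphically onto $\mathcal{C}$; each of these is called an oriented spread. An ordinary topological parallelism is a set of pairwise disjoint compact spreads covering $\mathcal{L}$ that is a compact subset of the hyperspace of all compact subsets of $\mathcal{L}$ (endowed with the Hausdorff topology). An oriented topological parallelism is a set of pairwise disjoint compact oriented spreads covering $\mathcal{L}^+$ that is a compact subset of the hyperspace of all compact subsets of $\mathcal{L}^+$. Parallelisms carry the subspace topology from these hyperspaces. *)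

(* Defs.v *)
From HB Require Import structures.
From mathcomp Require Import all_boot all_order all_algebra generic_quotient.
From mathcomp Require Import all_classical all_reals all_analysis.

Set Implicit Arguments.
Unset Strict Implicit.
Unset Printing Implicit Defensive.

Import Order.TTheory GRing.Theory Num.Theory.
Import numFieldNormedType.Exports.

Local Open Scope classical_set_scope.
Local Open Scope ring_scope.

(** * Homeomorphisms *)

Definition homeomorphism (X Y : topologicalType) (f : X -> Y) :=
  continuous f /\
  exists g : Y -> X, [/\ continuous g, cancel f g & cancel g f].

Definition homeomorphic (X Y : topologicalType) :=
  exists f : X -> Y, homeomorphism f.

(* The restriction of f is a homeomorphism of A onto B; the sets A and B are
   coerced to the types [set_type A] and [set_type B], which carry the subspace
   topology. *)
Definition maps_homeomorphically (X Y : topologicalType) (f : X -> Y)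
    (A : set X) (B : set Y) :=
  exists h : set_type A -> set_type B,
    homeomorphism h /\ forall x, \val (h x) = f (\val x).

(** * The hyperspace of compact subsets *)

Record hyperspace (R : realType) (X : topologicalType) := Hyperspace {
  compact_set :> set X;
  compact_setP : compact compact_set }.

HB.instance Definition _ R X := gen_eqMixin (hyperspace R X).
HB.instance Definition _ R X := gen_choiceMixin (hyperspace R X).

Section hausdorff_topology.
Variables (R : realType) (X : topologicalType).
Implicit Types (d : X -> X -> R) (A B : set X) (U : set (hyperspace R X)).

Definition metrizes d :=
  [/\ forall x y, 0 <= d x y,
      forall x y, d x y = 0 <-> x = y,
      forall x y, d x y = d y x,
      forall x y z, d x z <= d x y + d y z &
      forall x A, nbhs x A <->
        exists2 e : R, 0 < e & [set y | d x y < e] `<=` A].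

Definition thickening d A (e : R) := [set x | exists2 a, A a & d x a < e].

Definition hausdorff_near d (e : R) A B :=
  A `<=` thickening d B e /\ B `<=` thickening d A e.

(* On compact subsets of a metrizable space the Hausdorff metrics of all metrics
   that induce the topology define one and the same topology; quantifying over
   these metrics avoids the choice of a particular one.  (The definition is
   meant for metrizable X only.) *)
Definition hausdorff_open U :=
  forall d, metrizes d -> forall K, U K ->
    exists2 e : R, 0 < e &
      forall K' : hyperspace R X, hausdorff_near d e K K' -> U K'.

Lemma hausdorff_near_le d e e' A B : e <= e' ->
  hausdorff_near d e A B -> hausdorff_near d e' A B.
Proof.
move=> ee' [AB BA]; split => x.
- by move=> /AB[y By dxy]; exists y => //; exact: lt_le_trans ee'.
- by move=> /BA[y Ay dxy]; exists y => //; exact: lt_le_trans ee'.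
Qed.

Lemma hausdorff_openT : hausdorff_open setT.
Proof. by move=> d _ K _; exists 1. Qed.

Lemma hausdorff_openI : setI_closed hausdorff_open.
Proof.
move=> U V oU oV d md K [UK VK].
have [e e0 eU] := oU d md K UK; have [e' e'0 e'V] := oV d md K VK.
exists (Num.min e e'); first by rewrite lt_min e0.
move=> K' KK'; split; [apply: eU|apply: e'V];
  by apply: hausdorff_near_le KK'; rewrite ge_min lexx ?orbT.
Qed.

Lemma hausdorff_open_bigcup (I : Type) (F : I -> set (hyperspace R X)) :
  (forall i, hausdorff_open (F i)) -> hausdorff_open (\bigcup_i F i).
Proof.
move=> oF d md K [i _ FiK]; have [e e0 eF] := oF i d md K FiK.
by exists e => // K' /eF FiK'; exists i.
Qed.

HB.instance Definition _ := isOpenTopological.Build (hyperspace R X)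
  hausdorff_openT hausdorff_openI hausdorff_open_bigcup.

End hausdorff_topology.

(** * Lines and oriented lines of PG(3,R) *)

Section lines.
Variable R : realType.

Record line := Line {
  line_space :> {vspace 'rV[R]_4};
  line_dim : \dim line_space = 2 }.

(* The orientation determined by an ordered basis b. *)
Definition orientation_class (b : 2.-tuple 'rV[R]_4) : set (2.-tuple 'rV[R]_4) :=
  [set c | exists A : 'M[R]_2, 0 < \det A /\
     forall i, tnth c i = \sum_j A i j *: tnth b j].

Record oline := OLine {
  forget : line;
  orientation : set (2.-tuple 'rV[R]_4);
  orientationP :
    exists2 b : 2.-tuple 'rV[R]_4,
      basis_of forget b & orientation = orientation_class b }.

Definition GL4 := set_type [set M : 'M[R]_4 | M \in unitmx].

Definition gl_fun (g : GL4) : 'End('rV[R]_4) := linfun (mulmxr (\val g)).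

Lemma gl_funE g v : gl_fun g v = v *m \val g.
Proof. by rewrite lfunE. Qed.

Lemma gl_fun_lker g (U : {vspace 'rV[R]_4}) : (U :&: lker (gl_fun g))%VS = 0%VS.
Proof.
suff -> : lker (gl_fun g) = 0%VS by rewrite capv0.
apply/eqP/lker0P => u v; rewrite !gl_funE => /(congr1 (mulmxr (invmx (\val g)))).
have gu : \val g \in unitmx by have := set_valP g.
by rewrite /= !mulmxK.
Qed.

Lemma gl_line_subproof g (l : line) : \dim (gl_fun g @: l) = 2.
Proof. by rewrite limg_dim_eq ?gl_fun_lker ?line_dim. Qed.

Definition gl_line (g : GL4) (l : line) : line := Line (gl_line_subproof g l).

Lemma gl_oline_subproof g (l : oline) :
  exists2 b : 2.-tuple 'rV[R]_4, basis_of (gl_line g (forget l)) b &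
    [set map_tuple (gl_fun g) c | c in orientation l] = orientation_class b.
Proof.
have [b bl ->] := orientationP l; exists (map_tuple (gl_fun g) b).
  by rewrite /= limg_basis_of // gl_fun_lker.
apply/seteqP; split => [_ [c [A [A0 cA]] <-]|c [A [A0 cA]]].
  exists A; split => // i; rewrite tnth_map cA linear_sum.
  by apply: eq_bigr => j _; rewrite tnth_map linearZ.
exists [tuple \sum_j A i j *: tnth b j | i < 2].
  by exists A; split => // i; rewrite tnth_mktuple.
apply: eq_from_tnth => i; rewrite tnth_map tnth_mktuple cA linear_sum.
by apply: eq_bigr => j _; rewrite tnth_map linearZ.
Qed.

Definition gl_oline (g : GL4) (l : oline) : oline := OLine (gl_oline_subproof g l).

HB.instance Definition _ := gen_eqMixin line.
HB.instance Definition _ := gen_choiceMixin line.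
HB.instance Definition _ := gen_eqMixin oline.
HB.instance Definition _ := gen_choiceMixin oline.

(* The coset space topologies: the final topologies of the orbit maps
   g |-> g l.  Scalar matrices act trivially on lines and on oriented lines, and
   PGL(4,R) is a topological quotient of GL(4,R), so that GL(4,R) and PGL(4,R)
   define the same topology; by transitivity the base point l is irrelevant. *)
Definition line_open (U : set line) :=
  forall l, open ((fun g : GL4 => gl_line g l) @^-1` U).

Definition oline_open (U : set oline) :=
  forall l, open ((fun g : GL4 => gl_oline g l) @^-1` U).

Lemma line_openT : line_open setT.
Proof. by move=> l; rewrite preimage_setT; exact: openT. Qed.

Lemma line_openI : setI_closed line_open.
Proof. by move=> U V oU oV l; rewrite preimage_setI; exact: openI. Qed.

Lemma line_open_bigcup (I : Type) (F : I -> set line) :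
  (forall i, line_open (F i)) -> line_open (\bigcup_i F i).
Proof.
by move=> oF l; rewrite preimage_bigcup; apply: bigcup_open => i _; exact: oF.
Qed.

HB.instance Definition _ :=
  isOpenTopological.Build line line_openT line_openI line_open_bigcup.

Lemma oline_openT : oline_open setT.
Proof. by move=> l; rewrite preimage_setT; exact: openT. Qed.

Lemma oline_openI : setI_closed oline_open.
Proof. by move=> U V oU oV l; rewrite preimage_setI; exact: openI. Qed.

Lemma oline_open_bigcup (I : Type) (F : I -> set oline) :
  (forall i, oline_open (F i)) -> oline_open (\bigcup_i F i).
Proof.
by move=> oF l; rewrite preimage_bigcup; apply: bigcup_open => i _; exact: oF.
Qed.

HB.instance Definition _ :=
  isOpenTopological.Build oline oline_openT oline_openI oline_open_bigcup.

(** * Spreads and parallelisms *)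

Definition pg_points : set {vspace 'rV[R]_4} := [set p | \dim p = 1].

Definition points_on (l : line) : set {vspace 'rV[R]_4} :=
  [set p | pg_points p /\ (p <= l)%VS].

Definition compact_spread (C : set line) :=
  [/\ compact C, trivIset C points_on & cover C points_on = pg_points].

(* That S and S' are 2-spheres is a consequence of the last two conditions,
   since a compact spread C is a 2-sphere. *)
Definition oriented_spread (S : set oline) :=
  exists (C : set line) (S' : set oline),
    [/\ compact_spread C, S `&` S' = set0, S `|` S' = forget @^-1` C,
        maps_homeomorphically forget S C & maps_homeomorphically forget S' C].

Definition topological_parallelism (Pi : set (hyperspace R line)) :=
  [/\ forall C, Pi C -> compact_spread C,
      trivIset Pi (@compact_set R line),
      cover Pi (@compact_set R line) = setT &
      compact Pi].

Definition oriented_topological_parallelism (Pi : set (hyperspace R oline)) :=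
  [/\ forall S, Pi S -> oriented_spread S,
      trivIset Pi (@compact_set R oline),
      cover Pi (@compact_set R oline) = setT &
      compact Pi].

(** * The 2-sphere and the real projective plane *)

Definition sphere2 := set_type [set x : 'rV[R]_3 | \sum_i x 0 i ^+ 2 = 1].

HB.instance Definition _ := Topological.on sphere2.

Definition antipodal : rel sphere2 :=
  fun x y => (\val x == \val y) || (\val x == - \val y).

Lemma antipodal_equiv : equiv_class_of antipodal.
Proof.
split=> [x|x y|y x z]; rewrite /antipodal.
- by rewrite eqxx.
- by rewrite eq_sym [X in _ || X]eq_sym eqr_oppLR.
- move=> /orP[]/eqP-> /orP[]/eqP->; rewrite ?opprK ?eqxx ?orbT //.
Qed.

Canonical antipodal_equivRel := EquivRelPack antipodal_equiv.

Definition projective_plane := quotient_topology {eq_quot antipodal}%qT.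

HB.instance Definition _ := Topological.on projective_plane.

End lines.

(* Main.v *)
(* Fix a point p. Every (oriented) spread contains exactly one (oriented) line
   through p, so sending an (oriented) line through p to the member of the
   parallelism that contains it is a bijection of the star of p, which is a
   projective plane (a 2-sphere), onto the parallelism. It is continuous because
   the union of a compact family of compact sets is closed, hence it is a
   homeomorphism by compactness. *)
Require Import Defs.
From mathcomp Require Import all_boot all_order all_algebra generic_quotient.
From mathcomp Require Import all_classical all_reals all_analysis.
From mathcomp Require Import ring lra.

Set Implicit Arguments.
Unset Strict Implicit.
Unset Printing Implicit Defensive.

Import Order.TTheory GRing.Theory Num.Theory.
Import numFieldNormedType.Exports.

Local Open Scope classical_set_scope.
Local Open Scope ring_scope.

(** * Hyperspaces of Hausdorff spaces *)

(** The map from the star to the parallelism is chosen in this direction because its source is a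
    continuous image of the sphere, hence compact, while its target inherits the Hausdorff property
    from the hyperspace, and so in the end from the line spaces. The obstacle is the topology of the
    line spaces. Being final for the orbit maps of GL(4), it makes maps out of it easy to test, but
    neither maps into it nor separation of points. Frames bridge the gap: these are 2 x 4 matrices
    of rank 2 whose rows form an ordered basis of the line. A continuous family of frames gives a
    continuous family of lines, because nearby frames differ by a matrix of GL(4) close to 1.
    Conversely, the normalized Pluecker vector of a frame supplies continuous functions that
    separate lines or oriented lines. *)

Lemma separating_hausdorff (X Y : topologicalType) : hausdorff_space Y ->
  (forall x y : X, (forall f : X -> Y, continuous f -> f x = f y) -> x = y) ->
  hausdorff_space X.
Proof.
move=> hY sep p q pq; apply: sep => f cf; apply: hY => A B fpA fqB.
have [x [Ax Bx]] := pq _ _ (cf p _ fpA) (cf q _ fqB).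
by exists (f x).
Qed.

Lemma set_type_hausdorff (X : topologicalType) (A : set X) :
  hausdorff_space X -> hausdorff_space (set_type A).
Proof.
move=> hX; apply: (separating_hausdorff hX) => x y xy; apply: val_inj.
by apply: xy; exact: initial_continuous.
Qed.

Lemma compact_hausdorff_homeomorphism (X Y : topologicalType) (f : X -> Y) :
  compact [set: X] -> hausdorff_space Y -> continuous f -> injective f ->
  (forall y, exists x, f x = y) -> homeomorphism f.
Proof.
move=> cX hY cf fI fS; split => //.
pose g y := projT1 (cid (fS y)).
have gK : cancel g f by move=> y; rewrite /g; case: cid.
have fK : cancel f g by move=> x; apply: fI; rewrite gK.
exists g; split => //; apply/continuous_closedP => A cA.
rewrite (_ : g @^-1` A = f @` A); last first.
  by apply/seteqP; split => [y Agy|_ [x Ax <-]]; [exists (g y)|rewrite /= fK].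
apply: compact_closed => //; apply: continuous_compact.
  exact: continuous_subspaceT.
exact: subclosed_compact cA cX _.
Qed.

Lemma compact_separation (X : topologicalType) (K : set X) (x : X) :
  hausdorff_space X -> compact K -> ~ K x ->
  exists V W, [/\ open V, open W, V x, K `<=` W & V `&` W `<=` set0].
Proof.
move=> hX /compact_near_coveringP cK nKx.
(* [W] runs through ever smaller neighbourhoods of [x]. Compactness of [K] turns the local
   statements into a single [W0] whose closure misses all of [K]; its interior and the complement of
   its closure are the two open sets. *)
have /cK : forall y, K y -> \forall y' \near y &
    W \near powerset_filter_from (nbhs x), (fun W y' => ~ closure W y') W y'.
  move=> y Ky; have xy : x != y by apply/eqP => xy; apply: nKx; rewrite xy.
  have := hX; rewrite open_hausdorff => /(_ _ _ xy)[[A B] /=].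
  move=> [/set_mem Ax /set_mem By] [oA oB /eqP AB0].
  exists (B, [set W | nbhs x W /\ W `<=` A]).
    split; first exact: open_nbhs_nbhs.
    by apply: powerset_filter_fromP; exact: open_nbhs_nbhs.
  move=> [y' W] /= [By' [_ WA]] /(_ B (open_nbhs_nbhs (conj oB By')))[z [Wz Bz]].
  by rewrite -[False]/(set0 z) -AB0; split => //; exact: WA.
case=> M [MW _ [W0 MW0]] /(_ _ MW0) KW.
exists W0^°, (~` closure W0); split.
- exact: open_interior.
- by rewrite openC; exact: closed_closure.
- exact: MW.
- exact: KW.
- by move=> z [/interior_subset W0z]; apply; exact: subset_closure.
Qed.

Section hyperspace_theory.
Variables (R : realType) (X : topologicalType).
Implicit Types (U : set X) (Z : set (hyperspace R X)).

Lemma hyperspace_inj : injective (@compact_set R X).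
Proof.
by move=> [A cA] [B cB] /= AB; subst B; congr Hyperspace; exact: Prop_irrelevance.
Qed.

(** These sets and those of [open_hyperspace_subset] form the subbasis of the Vietoris topology. The
    later arguments on the hyperspace use only these two families, so that no metric has to be
    chosen. *)
Lemma open_hyperspace_meets U :
  open U -> open [set K : hyperspace R X | K `&` U !=set0].
Proof.
move=> oU; rewrite -[open _]/(hausdorff_open _) => d [_ _ _ _ dN] K [x [Kx Ux]].
have /dN[e e0 eU] : nbhs x U by exact: open_nbhs_nbhs.
by exists e => // K' [/(_ x Kx)[y Ky xy] _]; exists y; split => //; exact: eU.
Qed.

(* The e in the definition of [hausdorff_open] is a Lebesgue number of the
   cover [set U] of K. *)
Lemma open_hyperspace_subset U :
  open U -> open [set K : hyperspace R X | K `<=` U].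
Proof.
move=> oU; rewrite -[open _]/(hausdorff_open _) => d [_ _ dC dT dN] K KU.
have /compact_near_coveringP cK : compact (compact_set K) by case: K {KU}.
have /cK : forall x, compact_set K x -> \forall x' \near x & e \near (0 : R)^'+,
    (fun e x' => forall y, d x' y < e -> U y) e x'.
  move=> x /KU Ux; have /dN[e e0 eU] : nbhs x U by exact: open_nbhs_nbhs.
  have e20 : 0 < e / 2 by rewrite divr_gt0.
  exists ([set x' | d x x' < e / 2], [set e' | e' < e / 2]) => /=.
    split; first by apply/dN; exists (e / 2).
    exact: nbhs_right_lt.
  move=> [x' e'] /= [xx' e'e] y x'y; apply: eU => /=.
  rewrite (le_lt_trans (dT _ x' _))// [e]splitr ltrD//.
  exact: lt_trans e'e.
rewrite near_withinE => /nbhs_ballP[e /= e0 eU].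
have e20 : 0 < e / 2 by rewrite divr_gt0.
exists (e / 2) => // K' [_ K'K] y /K'K[x Kx yx].
apply: (eU (e / 2) _ _ x) => //; last by rewrite dC.
by rewrite /ball /= sub0r normrN gtr0_norm// ltr_pdivrMr// ltr_pMr// ltr1n.
Qed.

(** If a point of one compact set lies outside another, disjoint open sets [V] and [W] separate the
    point from the latter, and no set can both meet [V] and lie in [W]. *)
Lemma hyperspace_hausdorff :
  hausdorff_space X -> hausdorff_space (hyperspace R X).
Proof.
move=> hX; have sub (K K' : hyperspace R X) : cluster (nbhs K) K' ->
    (compact_set K `<=` compact_set K') /\ (compact_set K' `<=` compact_set K).
  move=> KK'; split => x Kx; apply: contrapT => nKx.
  - have [V [W [oV oW Vx KW VW]]] :=
      compact_separation hX (@compact_setP R X K') nKx.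
    have [] := KK' _ _
      (open_nbhs_nbhs (conj (open_hyperspace_meets oV)
        (ex_intro _ x (conj Kx Vx))))
      (open_nbhs_nbhs (conj (open_hyperspace_subset oW) KW)).
    by move=> L [[y [Ly Vy]] LW]; apply: (VW y); split => //; exact: LW.
  - have [V [W [oV oW Vx KW VW]]] :=
      compact_separation hX (@compact_setP R X K) nKx.
    have [] := KK' _ _
      (open_nbhs_nbhs (conj (open_hyperspace_subset oW) KW))
      (open_nbhs_nbhs (conj (open_hyperspace_meets oV)
        (ex_intro _ x (conj Kx Vx)))).
    by move=> L [LW [y [Ly Vy]]]; apply: (VW y); split => //; exact: LW.
by move=> K K' /sub[KK' K'K]; apply/hyperspace_inj/seteqP.
Qed.

Lemma closed_compact_cover Z : hausdorff_space X -> compact Z ->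
  closed (cover Z (@compact_set R X)).
Proof.
move=> hX /compact_near_coveringP cZ.
(* A member of [Z] and all sets near it miss some neighbourhood of [x], which may depend on the
   member; compactness of [Z] yields one neighbourhood [W0] missed by every member. *)
rewrite -openC openE => x nZx; have /cZ : forall K : hyperspace R X, Z K ->
    \forall K' \near K & W \near powerset_filter_from (nbhs x),
      (fun W (K' : hyperspace R X) => W `&` compact_set K' = set0) W K'.
  move=> K ZK; have nKx : ~ compact_set K x by move=> Kx; apply: nZx; exists K.
  have [V [W [oV oW Vx KW VW]]] :=
    compact_separation hX (@compact_setP R X K) nKx.
  exists ([set K' : hyperspace R X | K' `<=` W], [set A | nbhs x A /\ A `<=` V]).
    split; first exact: open_nbhs_nbhs (conj (open_hyperspace_subset oW) KW).
    by apply: powerset_filter_fromP; exact: open_nbhs_nbhs.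
  move=> [K' A] /= [K'W [_ AV]]; rewrite -subset0 => y [/AV Vy /K'W Wy].
  exact: (VW y).
case=> M [MW _ [W0 MW0]] /(_ _ MW0) ZW.
apply: filterS (MW _ MW0) => y W0y [K ZK Ky].
by have := ZW _ ZK; rewrite -subset0 => /(_ y); apply.
Qed.

Lemma continuous_selection (T : topologicalType) (ell : T -> X) Z :
  hausdorff_space X -> compact Z -> trivIset Z (@compact_set R X) ->
  cover Z (@compact_set R X) = setT -> continuous ell ->
  exists2 f : T -> set_type Z, continuous f &
    forall x, compact_set (\val (f x)) (ell x).
Proof.
move=> hX cZ tZ cov cell.
have selP x : exists K : set_type Z, compact_set (\val K) (ell x).
  have : cover Z (@compact_set R X) (ell x) by rewrite cov.
  by case=> K ZK Kx; exists (exist _ K (mem_set ZK)).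
pose f x := projT1 (cid (selP x)).
have fP x : compact_set (\val (f x)) (ell x) by rewrite /f; case: cid.
exists f => //; apply/continuousP => _ [U oU <-].
(* Since the members are disjoint, [f x] lies outside [U] exactly when [ell x] lies on some member
   outside [U]. These members form a compact family, so their union is closed. *)
rewrite (_ : _ @^-1` _ = ~` (ell @^-1` cover (Z `&` ~` U) (@compact_set R X))).
  rewrite openC; apply: closed_comp => [x _|]; first exact: cell.
  apply: closed_compact_cover => //.
  by apply: compact_closedI => //; rewrite closedC.
apply/seteqP; split => x /=.
  move=> Ufx [K [ZK nUK] Kx]; apply: nUK.
  suff -> : K = set_val (f x) by [].
  by apply: (tZ _ _ ZK (set_valP (f x))); exists (ell x); split => //; exact: fP.
move=> nx; apply: contrapT => nU; apply: nx.
exists (set_val (f x)); last exact: fP.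
by split => //; exact: set_valP.
Qed.

End hyperspace_theory.

(** * Lines as row spaces *)

Section matrix_limits.
Context (R : realType) (T : Type) (F : set_system T) {FF : Filter F}.

Lemma cvg_mx m n (f : T -> 'M[R]_(m, n)) (M : 'M[R]_(m, n)) :
  (forall i j, f x i j @[x --> F] --> M i j) -> f x @[x --> F] --> M.
Proof.
move=> fM A [P PM PA]; have : \forall x \near F, forall i j, P i j (f x i j).
  by apply: filter_forall => i; apply: filter_forall => j; exact: fM.
by apply: filterS => x fP; exact: PA.
Qed.

Lemma cvg_coord m n (f : T -> 'M[R]_(m, n)) (M : 'M[R]_(m, n)) i j :
  f x @[x --> F] --> M -> f x i j @[x --> F] --> M i j.
Proof.
by move=> fM; exact: (cvg_comp _ _ fM (@coord_continuous _ _ _ i j M)).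
Qed.

Lemma cvg_mulmx m n p (f : T -> 'M[R]_(m, n)) (g : T -> 'M[R]_(n, p))
    (M : 'M[R]_(m, n)) (N : 'M[R]_(n, p)) :
  f x @[x --> F] --> M -> g x @[x --> F] --> N ->
  f x *m g x @[x --> F] --> M *m N.
Proof.
move=> fM gN; apply: cvg_mx => i j; under eq_fun do rewrite mxE; rewrite mxE.
apply: cvg_big => [|k _]; first exact: add_continuous.
by apply: cvgM; exact: cvg_coord.
Qed.

Lemma cvg_trmx m n (f : T -> 'M[R]_(m, n)) (M : 'M[R]_(m, n)) :
  f x @[x --> F] --> M -> (f x)^T @[x --> F] --> M^T.
Proof.
move=> fM; apply: cvg_mx => i j; under eq_fun do rewrite mxE; rewrite mxE.
exact: cvg_coord.
Qed.

Lemma cvg_det n (f : T -> 'M[R]_n) (M : 'M[R]_n) :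
  f x @[x --> F] --> M -> \det (f x) @[x --> F] --> \det M.
Proof.
move=> fM; apply: cvg_big => [|s _]; first exact: add_continuous.
apply: cvgM; first exact: cvg_cst.
by apply: cvg_big => [|i _]; [exact: mul_continuous|exact: cvg_coord].
Qed.

End matrix_limits.

(** * Ordered bases of lines as 2 x 4 matrices of rank 2 *)

Section frames.
Variable R : realType.
Implicit Types (l : line R) (o : oline R) (B C : 'M[R]_(2, 4)) (A : 'M[R]_2).

(** In matrix form a change of basis is a left factor from GL(2) and the action of GL(4) is a right
    factor, so the two commute by associativity. *)
Definition mxrows B : 2.-tuple 'rV[R]_4 := [tuple row i B | i < 2].

Lemma mxrowsE B i : tnth (mxrows B) i = row i B.
Proof. by rewrite tnth_mktuple. Qed.

Lemma nth_mxrows B (i : 'I_2) : (mxrows B)`_i = row i B.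
Proof. by rewrite -tnth_nth mxrowsE. Qed.

Lemma mxrowsK (b : 2.-tuple 'rV[R]_4) : mxrows (\matrix_i tnth b i) = b.
Proof. by apply: eq_from_tnth => i; rewrite mxrowsE rowK. Qed.

Lemma free_mxrows B : free (mxrows B) = row_free B.
Proof.
have sumE (k : 'I_2 -> R) :
    \sum_i k i *: (mxrows B)`_i = (\row_i k i) *m B.
  rewrite mulmx_sum_row; apply: eq_bigr => i _.
  by rewrite mxE nth_mxrows.
apply/freeP/idP => [fB|fB k].
  apply: inj_row_free => v vB; apply/rowP => i; rewrite mxE.
  apply: fB; rewrite sumE -[RHS]vB; congr (_ *m _).
  by apply/rowP => j; rewrite mxE.
rewrite sumE -(mul0mx _ B) => /(row_free_inj fB)/rowP k0 i.
by have := k0 i; rewrite !mxE.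
Qed.

Lemma span_mxrows B v : (v \in <<mxrows B>>%VS) = (v <= B)%MS.
Proof.
apply/idP/submxP => [/coord_span->|[D ->]].
  exists (\row_i coord (mxrows B) i v); rewrite mulmx_sum_row.
  by apply: eq_bigr => i _; rewrite mxE nth_mxrows.
rewrite mulmx_sum_row; apply: memv_suml => i _; apply/memvZ/memv_span.
by rewrite -mxrowsE mem_tnth.
Qed.

Definition line_frame l B := basis_of l (mxrows B).

Definition oline_frame o B :=
  line_frame (forget o) B /\ orientation o = orientation_class (mxrows B).

Lemma line_inj l l' : line_space l = line_space l' -> l = l'.
Proof.
case: l l' => [U dU] [V dV] /= UV; subst V.
by congr Line; exact: Prop_irrelevance.
Qed.

Lemma oline_inj o u :
  forget o = forget u -> orientation o = orientation u -> o = u.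
Proof.
case: o u => [l w wP] [l' w' wP'] /= ll' ww'; subst l' w'.
by congr OLine; exact: Prop_irrelevance.
Qed.

Lemma line_frame_free l B : line_frame l B -> row_free B.
Proof. by move=> /basis_free; rewrite free_mxrows. Qed.

Lemma mem_line_frame l B v : line_frame l B -> (v \in line_space l) = (v <= B)%MS.
Proof. by move=> /span_basis <-; rewrite span_mxrows. Qed.

Lemma line_frameP l B :
  row_free B -> (forall i, row i B \in line_space l) -> line_frame l B.
Proof.
move=> fB Bl; rewrite /line_frame basisEfree free_mxrows fB size_tuple line_dim.
by rewrite leqnn andbT; apply/span_subvP => v /tnthP[i ->]; rewrite mxrowsE.
Qed.

Lemma line_frame_ex l : exists B, line_frame l B.
Proof.
exists (\matrix_i tnth (tcast (line_dim l) (vbasis l)) i).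
rewrite /line_frame mxrowsK.
by rewrite /basis_of val_tcast; exact: vbasisP.
Qed.

Lemma oline_frame_ex o : exists B, oline_frame o B.
Proof.
have [b bo oE] := orientationP o; exists (\matrix_i tnth b i).
by rewrite /oline_frame /line_frame mxrowsK.
Qed.

Lemma row_free_line B : row_free B -> exists l, line_frame l B.
Proof.
move=> fB; have dB : \dim <<mxrows B>> = 2%N.
  by move: fB; rewrite -free_mxrows /free size_tuple => /eqP.
exists (Line dB); apply: line_frameP => // i /=.
by rewrite span_mxrows row_sub.
Qed.

Lemma row_free_oline B : row_free B -> exists o, oline_frame o B.
Proof.
move=> /row_free_line[l lB].
by exists (OLine (ex_intro2 _ _ (mxrows B) lB erefl)).
Qed.

Lemma line_frame_sub l l' B C :
  line_frame l B -> line_frame l' C -> (B <= C)%MS -> l = l'.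
Proof.
move=> lB l'C BC; apply/line_inj/eqP; rewrite eqEdim !line_dim leqnn andbT.
apply/subvP => v; rewrite (mem_line_frame _ lB) (mem_line_frame _ l'C) => vB.
exact: submx_trans BC.
Qed.

Lemma line_frame_inj l l' B : line_frame l B -> line_frame l' B -> l = l'.
Proof. by move=> lB l'B; exact: line_frame_sub lB l'B _. Qed.

Lemma line_frame_change l B C : line_frame l B -> line_frame l C ->
  exists2 A, \det A != 0 & C = A *m B.
Proof.
move=> lB lC; have /submxP[A CA] : (C <= B)%MS.
  apply/row_subP => i; rewrite -(mem_line_frame _ lB) (mem_line_frame _ lC).
  exact: row_sub.
exists A => //; rewrite -unitfE -[_ \in _]/(A \in unitmx) -row_free_unit.
(* A row vector killed by [A] is killed by [A *m B], which has independent rows. *)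
have := line_frame_free lC; rewrite CA -!kermx_eq0 => /eqP kAB.
apply/eqP; apply/eqP; rewrite -submx0 -kAB; apply/sub_kermxP.
by rewrite mulmxA mulmx_ker mul0mx.
Qed.

Lemma line_frameM l B A :
  line_frame l B -> \det A != 0 -> line_frame l (A *m B).
Proof.
move=> lB A0; apply: line_frameP => [|i]; last first.
  by rewrite (mem_line_frame _ lB) row_mul submxMl.
rewrite /row_free mxrankMfree ?(line_frame_free lB)//.
by rewrite -/(row_free A) row_free_unit unitmxE unitfE.
Qed.

Lemma orientation_classP B C :
  orientation_class (mxrows B) (mxrows C) <-> exists2 A, 0 < \det A & C = A *m B.
Proof.
split=> [[A [A0 CA]]|[A A0 ->]]; exists A => //.
  apply/row_matrixP => i; rewrite -mxrowsE CA row_mul mulmx_sum_row.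
  by apply: eq_bigr => j _; rewrite mxrowsE mxE.
split=> // i; rewrite mxrowsE row_mul mulmx_sum_row.
by apply: eq_bigr => j _; rewrite mxrowsE mxE.
Qed.

Lemma orientation_classM B A : 0 < \det A ->
  orientation_class (mxrows (A *m B)) = orientation_class (mxrows B).
Proof.
move=> A0; have Au : A \in unitmx by rewrite unitmxE unitfE gt_eqF.
apply/seteqP; split => c; rewrite -[c]mxrowsK => /orientation_classP[A' A'0 ->];
  apply/orientation_classP.
- by exists (A' *m A); rewrite ?det_mulmx ?mulr_gt0// mulmxA.
- exists (A' *m invmx A); last by rewrite -mulmxA mulKmx.
  by rewrite det_mulmx det_inv mulr_gt0 ?invr_gt0.
Qed.

Lemma oline_frame_change o B C : oline_frame o B -> oline_frame o C ->
  exists2 A, 0 < \det A & C = A *m B.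
Proof.
move=> [_ oB] [_ oC]; apply/orientation_classP; rewrite -oB oC.
by apply/orientation_classP; exists 1%:M; rewrite ?det1 ?mul1mx.
Qed.

Lemma oline_frameM o B A :
  oline_frame o B -> 0 < \det A -> oline_frame o (A *m B).
Proof.
move=> [oB oE] A0; split; first by rewrite line_frameM// gt_eqF.
by rewrite orientation_classM.
Qed.

Lemma oline_frame_inj o u B : oline_frame o B -> oline_frame u B -> o = u.
Proof.
move=> [oB oE] [uB uE]; apply: oline_inj; last by rewrite oE uE.
exact: line_frame_inj oB uB.
Qed.

Lemma map_mxrows (g : GL4 R) B :
  map_tuple (gl_fun g) (mxrows B) = mxrows (B *m \val g).
Proof.
by apply: eq_from_tnth => i; rewrite tnth_map !mxrowsE gl_funE row_mul.
Qed.

Lemma gl_line_frame g l B :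
  line_frame l B -> line_frame (gl_line g l) (B *m \val g).
Proof.
by move=> lB; rewrite /line_frame -map_mxrows /= limg_basis_of// gl_fun_lker.
Qed.

Lemma gl_oline_frame g o B :
  oline_frame o B -> oline_frame (gl_oline g o) (B *m \val g).
Proof.
move=> [oB oE]; split; first exact: gl_line_frame.
rewrite /= oE; apply/seteqP; split => [_ [c + <-]|c]; rewrite -[c]mxrowsK.
  rewrite map_mxrows => /orientation_classP[A A0 ->].
  by apply/orientation_classP; exists A; rewrite ?mulmxA.
move=> /orientation_classP[A A0 ->]; exists (mxrows (A *m B)).
  by apply/orientation_classP; exists A.
by rewrite map_mxrows mulmxA.
Qed.

End frames.

(** * The topology of the line spaces *)

Section frame_topology.
Variables (R : realType) (X : topologicalType).
Variables (act : GL4 R -> X -> X) (frame : X -> 'M[R]_(2, 4) -> Prop).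
Hypothesis X_open : forall U : set X,
  open U <-> forall x, open ((fun g : GL4 R => act g x) @^-1` U).
Hypothesis frame_ex : forall x, exists B, frame x B.
Hypothesis frame_free : forall x B, frame x B -> row_free B.
Hypothesis frame_act : forall g x B, frame x B -> frame (act g x) (B *m \val g).
Hypothesis frame_inj : forall x y B, frame x B -> frame y B -> x = y.

(** The section hypotheses hold for lines and for oriented lines alike. On an orbit, a fixed frame
    [B] of [x] turns [phi] into the matrix function sending [g] to [f (B *m g)]. Continuity of [f]
    is asked for only at rank 2, because the [f] used later divides by a norm. *)
Lemma frame_factor_continuous (Y : topologicalType) (phi : X -> Y)
    (f : 'M[R]_(2, 4) -> Y) :
  (forall B, row_free B -> {for B, continuous f}) ->
  (forall x B, frame x B -> phi x = f B) -> continuous phi.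
Proof.
move=> cf phiE; apply/continuousP => V oV; apply/X_open => x.
have [B xB] := frame_ex x.
rewrite (_ : _ @^-1` _ = (fun g : GL4 R => f (B *m \val g)) @^-1` V); last first.
  by apply/seteqP; split => g /=; rewrite (phiE _ _ (frame_act g xB)).
move: V oV; apply/continuousP => g.
apply: (@continuous_comp _ _ _ (fun h : GL4 R => B *m \val h) f).
  apply: (@cvg_mulmx _ _ (nbhs g)); first exact: cvg_cst.
  exact: initial_continuous.
exact/cf/frame_free/(frame_act g xB).
Qed.

(* Near x the frame F y is the image of F x under the matrix
   1 + (F x)^+ (F y - F x), which is invertible by continuity. *)
Lemma continuous_of_frame (T : topologicalType) (F : T -> 'M[R]_(2, 4))
    (phi : T -> X) :
  continuous F -> (forall x, frame (phi x) (F x)) -> continuous phi.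
Proof.
move=> cF phiF; apply/continuousP => U /X_open oU; rewrite openE => x Ux.
have [V oV VE] := oU (phi x).
pose g y : 'M[R]_4 := 1%:M + pinvmx (F x) *m (F y - F x).
have gF y : F x *m g y = F y.
  rewrite mulmxDr mulmx1 mulmxA mulmxVp ?(frame_free (phiF x))//.
  by rewrite mul1mx subrKC.
have gx : g x = 1%:M by rewrite /g subrr mulmx0 addr0.
have g_cvg : g y @[y --> x] --> (1%:M : 'M[R]_4).
  rewrite -gx; apply: cvgD; first exact: cvg_cst.
  apply: cvg_mulmx; first exact: cvg_cst.
  by apply: cvgB; [exact: cF|exact: cvg_cst].
have phiE y (gu : g y \in unitmx) :
    act (exist _ (g y) (mem_set gu)) (phi x) = phi y.
  apply: frame_inj (phiF y); rewrite -(gF y).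
  exact: (frame_act (exist _ (g y) (mem_set gu))).
have g_unit : \forall y \near x, g y \in unitmx.
  have det_cvg : \det (g y) @[y --> x] --> (1 : R).
    by rewrite -(det1 R 4); exact: cvg_det.
  have : \forall y \near x, \det (g y) != 0.
    exact: cvgr_neq0 det_cvg (oner_neq0 _).
  by apply: filterS => y; rewrite unitmxE unitfE.
have V1 : V 1%:M.
  rewrite -gx; have gu : g x \in unitmx by rewrite gx unitmx1.
  have : (set_val @^-1` V) (exist _ (g x) (mem_set gu) : GL4 R).
    by rewrite VE /= phiE.
  by [].
have g_V : \forall y \near x, V (g y).
  by apply: g_cvg; exact: open_nbhs_nbhs.
apply: filterS2 g_unit g_V => y gu Vy /=; rewrite -(phiE y gu).
by rewrite -[U _]/(((fun h : GL4 R => act h (phi x)) @^-1` U)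
  (exist _ (g y) (mem_set gu))) -VE.
Qed.

End frame_topology.

(** * Pluecker vectors of frames *)

Section pluecker.
Variable R : realType.
Implicit Types (l : line R) (o : oline R) (B C : 'M[R]_(2, 4)) (A : 'M[R]_2).

(** The standard alternating form, with rows (0, 1) and (-1, 0); a 2 x 2 matrix multiplies it by its
    determinant. *)
Let J : 'M[R]_2 := \matrix_(i, j) ((j : nat)%:R - (i : nat)%:R).

(* The entry (i, j) is the minor of B on the columns i and j. *)
Definition pluecker B : 'M[R]_4 := B^T *m J *m B.

(** A change of frame multiplies the Pluecker vector by a determinant; normalizing leaves only its
    sign. The result depends only on the oriented line, and up to sign only on the line. *)
Definition unit_pluecker B := `|pluecker B|^-1 *: pluecker B.

Lemma ord2P (i : 'I_2) : i = 0 \/ i = 1.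
Proof. by case: i => [[|[|//]] i2]; [left|right]; apply: val_inj. Qed.

Lemma sum_ord2 (V : nmodType) (f : 'I_2 -> V) : \sum_i f i = f 0 + f 1.
Proof.
by rewrite !big_ord_recl big_ord0 addr0; congr (_ + f _); apply: val_inj.
Qed.

Lemma det_mx22 A : \det A = A 0 0 * A 1 1 - A 0 1 * A 1 0.
Proof.
rewrite (expand_det_row _ 0) sum_ord2 /cofactor !det_mx11 !mxE.
rewrite /= expr0 expr1 mul1r mulN1r mulrN.
by congr (_ * A _ _ - _ * A _ _); apply: val_inj.
Qed.

Lemma plueckerM A B : pluecker (A *m B) = \det A *: pluecker B.
Proof.
suff AJ : A^T *m J *m A = \det A *: J.
  by rewrite /pluecker scalemxAl scalemxAr -AJ trmx_mul !mulmxA.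
apply/matrixP => i j; rewrite det_mx22 /J !mxE !sum_ord2 !mxE !sum_ord2 !mxE.
by case: (ord2P i) => ->; case: (ord2P j) => ->; rewrite /=; ring.
Qed.

(** This recovers a line from its Pluecker vector. If [B *m C = 1], then [C^T] cancels the left
    factor [B^T], and [- J] undoes the remaining [J] because [J] squares to -1. *)
Lemma sub_pluecker B : row_free B -> (B <= pluecker B)%MS.
Proof.
move=> /row_freeP[C BC]; apply/submxP; exists (- J *m C^T).
have JJ : J *m J = - 1%:M.
  apply/matrixP => i j; rewrite /J !mxE !sum_ord2 !mxE.
  by case: (ord2P i) => ->; case: (ord2P j) => ->;
    rewrite /= -[(1 %% 2)%N]/1%N; ring.
rewrite /pluecker !mulmxA -(mulmxA (- J)) -trmx_mul BC trmx1 mulmx1.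
by rewrite mulNmx JJ opprK mul1mx.
Qed.

Lemma pluecker_neq0 B : row_free B -> pluecker B != 0.
Proof.
move=> fB; apply/eqP => W0; have := mxrankS (sub_pluecker fB).
by rewrite (eqP fB) W0 mxrank0.
Qed.

Lemma unit_plueckerM A B :
  unit_pluecker (A *m B) = Num.sg (\det A) *: unit_pluecker B.
Proof.
rewrite /unit_pluecker plueckerM normrZ invfM !scalerA; congr (_ *: _).
have [->|d0] := eqVneq (\det A) 0; first by rewrite sgr0 mulr0 mul0r.
rewrite mulrAC; congr (_ * _).
by rewrite {2}[\det A]numEsg mulrCA mulVf ?mulr1// normr_eq0.
Qed.

Lemma unit_pluecker_neq0 B : row_free B -> unit_pluecker B != 0.
Proof.
by move=> fB; rewrite scaler_eq0 invr_eq0 normr_eq0 orbb pluecker_neq0.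
Qed.

Lemma cvg_pluecker (T : Type) (F : set_system T) {FF : Filter F}
    (f : T -> 'M[R]_(2, 4)) B :
  f x @[x --> F] --> B -> pluecker (f x) @[x --> F] --> pluecker B.
Proof.
move=> fB; apply: (cvg_mulmx _ fB); apply: cvg_mulmx; first exact: cvg_trmx.
exact: cvg_cst.
Qed.

Lemma unit_pluecker_continuous B :
  row_free B -> {for B, continuous unit_pluecker}.
Proof.
move=> fB; have cW : pluecker C @[C --> B] --> pluecker B.
  by apply: (@cvg_pluecker _ (nbhs B)); exact: cvg_id.
have cN : `|pluecker C| @[C --> B] --> `|pluecker B|.
  exact: (cvg_norm cW).
have nB : `|pluecker B| != 0 by rewrite normr_eq0 pluecker_neq0.
exact: cvgZ (cvgV nB cN) cW.
Qed.

Lemma unit_pluecker_coord_continuous B i j :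
  row_free B -> {for B, continuous (fun C => unit_pluecker C i j)}.
Proof. by move=> fB; apply: cvg_coord; exact: unit_pluecker_continuous. Qed.

Lemma unit_pluecker_sub B C (s : R) : row_free B ->
  unit_pluecker B = s *: unit_pluecker C -> (B <= C)%MS.
Proof.
move=> fB BC; apply: submx_trans (sub_pluecker fB) _.
have nW : `|pluecker B| != 0 by rewrite normr_eq0 pluecker_neq0.
have -> : pluecker B = `|pluecker B| *: unit_pluecker B.
  by rewrite scalerA mulfV// scale1r.
by rewrite BC !scalerA; apply/scalemx_sub/submxMl.
Qed.

End pluecker.

(** * Separation of lines and of oriented lines *)

Section line_topology.
Variable R : realType.

Lemma line_frame_factor_continuous (Y : topologicalType) (phi : line R -> Y)
    (f : 'M[R]_(2, 4) -> Y) :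
  (forall B, row_free B -> {for B, continuous f}) ->
  (forall l B, line_frame l B -> phi l = f B) -> continuous phi.
Proof.
apply: (@frame_factor_continuous R _ (@gl_line R) (@line_frame R)) => //.
- exact: line_frame_ex.
- exact: line_frame_free.
- exact: gl_line_frame.
Qed.

Lemma continuous_of_line_frame (T : topologicalType) (F : T -> 'M[R]_(2, 4))
    (phi : T -> line R) :
  continuous F -> (forall x, line_frame (phi x) (F x)) -> continuous phi.
Proof.
apply: (@continuous_of_frame R _ (@gl_line R) (@line_frame R)) => //.
- exact: line_frame_free.
- exact: gl_line_frame.
- exact: line_frame_inj.
Qed.

Lemma oline_frame_factor_continuous (Y : topologicalType) (phi : oline R -> Y)
    (f : 'M[R]_(2, 4) -> Y) :
  (forall B, row_free B -> {for B, continuous f}) ->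
  (forall o B, oline_frame o B -> phi o = f B) -> continuous phi.
Proof.
apply: (@frame_factor_continuous R _ (@gl_oline R) (@oline_frame R)) => //.
- exact: oline_frame_ex.
- by move=> o B [/line_frame_free].
- exact: gl_oline_frame.
Qed.

Lemma continuous_of_oline_frame (T : topologicalType) (F : T -> 'M[R]_(2, 4))
    (phi : T -> oline R) :
  continuous F -> (forall x, oline_frame (phi x) (F x)) -> continuous phi.
Proof.
apply: (@continuous_of_frame R _ (@gl_oline R) (@oline_frame R)) => //.
- by move=> o B [/line_frame_free].
- exact: gl_oline_frame.
- exact: oline_frame_inj.
Qed.

(* The products of two coordinates of a unit Pluecker vector do not depend on
   its sign and determine it up to sign. *)
Lemma line_hausdorff : hausdorff_space (line R).
Proof.
apply: (separating_hausdorff (@Rhausdorff R)) => l l' sep.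
have [[B lB] [C l'C]] := (line_frame_ex l, line_frame_ex l').
have fB := line_frame_free lB.
pose F i j k m D : R := unit_pluecker D i j * unit_pluecker D k m.
have FE i j k m : F i j k m B = F i j k m C.
  pose phi h := F i j k m (projT1 (cid (line_frame_ex h))).
  have phiE h D : line_frame h D -> phi h = F i j k m D.
    rewrite /phi; case: cid => /= E hE hD.
    have [A A0 ->] := line_frame_change hD hE.
    by rewrite /F unit_plueckerM !mxE mulrACA -expr2 sqr_sg A0 mul1r.
  rewrite -(phiE _ _ lB) -(phiE _ _ l'C); apply: sep.
  apply: line_frame_factor_continuous phiE => D fD.
  have cD a b := @unit_pluecker_coord_continuous R D a b fD.
  exact: cvgM (cD i j) (cD k m).
have /matrix0Pn[i [j Bij]] := unit_pluecker_neq0 fB.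
apply: (line_frame_sub lB l'C).
(* Dividing the equality of products [FE i j k m] by the nonzero entry [unit_pluecker B i j] shows
   that the two vectors are proportional with this factor. *)
pose s := unit_pluecker C i j / unit_pluecker B i j.
apply: (@unit_pluecker_sub _ _ _ s) => //.
apply/matrixP => k m; apply: (mulfI Bij).
rewrite [(_ *: unit_pluecker C) k m]mxE mulrA.
by rewrite (mulrCA (unit_pluecker B i j)) mulfV// mulr1; exact: FE.
Qed.

(** Here the coordinates of the unit Pluecker vector are themselves well defined. Equal vectors give
    the same line, and a change of frame with negative determinant would reverse the vector, so the
    orientations agree too. *)
Lemma oline_hausdorff : hausdorff_space (oline R).
Proof.
apply: (separating_hausdorff (@Rhausdorff R)) => o u sep.
have [[B oB] [C uC]] := (oline_frame_ex o, oline_frame_ex u).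
have fB := line_frame_free oB.1.
have WE : unit_pluecker B = unit_pluecker C.
  apply/matrixP => i j.
  pose phi (v : oline R) : R :=
    unit_pluecker (projT1 (cid (oline_frame_ex v))) i j.
  have phiE h D : oline_frame h D -> phi h = unit_pluecker D i j.
    rewrite /phi; case: cid => /= E hE hD.
    have [A A0 ->] := oline_frame_change hD hE.
    by rewrite unit_plueckerM gtr0_sg// scale1r.
  rewrite -(phiE _ _ oB) -(phiE _ _ uC); apply: sep.
  apply: oline_frame_factor_continuous phiE => D fD.
  exact: unit_pluecker_coord_continuous.
have ou : forget o = forget u.
  apply: (line_frame_sub oB.1 uC.1); apply: (@unit_pluecker_sub _ _ _ 1) => //.
  by rewrite scale1r.
have uB : line_frame (forget u) B by rewrite -ou; exact: oB.1.
have [A A0 CA] := line_frame_change uB uC.1.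
have {}A0 : 0 < \det A.
  move: WE; rewrite CA unit_plueckerM => /eqP.
  rewrite -subr_eq0 -{1}[unit_pluecker B]scale1r -scalerBl scaler_eq0.
  rewrite (negPf (unit_pluecker_neq0 fB)) orbF subr_eq0 eq_sym.
  by move=> /eqP sA; rewrite -sgr_gt0 sA.
apply: (oline_frame_inj (oline_frameM oB A0)); rewrite -CA; exact: uC.
Qed.

End line_topology.

(** * The star of a point *)

Lemma homeomorphic_sym (X Y : topologicalType) :
  homeomorphic X Y -> homeomorphic Y X.
Proof. by case=> f [cf [g [cg fK gK]]]; exists g; split => //; exists f. Qed.

Lemma compact_set_type (X : topologicalType) (A : set X) :
  compact A -> compact [set: set_type A].
Proof.
move=> cA F FF _.
pose v : set_type A -> X := set_val.
have FA : F (v @^-1` A) by apply: filterE => x; exact: (set_valP x).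
have [p [Ap clp]] := cA (v @ F) _ FA.
exists (exist _ p (mem_set Ap)); split => // U V FU.
rewrite nbhsE => -[_ [[W oW <-] Wp] WV].
have FvU : F (v @^-1` (v @` U)) by apply: filterS FU; exact: preimage_image.
have [] := clp (v @` U) W FvU (open_nbhs_nbhs (conj oW Wp)).
by move=> _ [[x Ux <-] Wx]; exists x; split => //; exact: WV.
Qed.

Section sphere.
Variable R : realType.

Lemma sphere2_compact : compact [set: sphere2 R].
Proof.
apply: compact_set_type; apply: bounded_closed_compact.
  exists 1; split => // M M1 x /= x1; apply: le_trans (ltW M1).
  rewrite [leLHS]/Num.norm /= mx_normrE; apply: bigmax_le => // -[i j] _ /=.
  have : x 0 j ^+ 2 <= 1.
    by rewrite -x1 (bigD1 j)//= lerDl sumr_ge0// => k _; exact: sqr_ge0.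
  by rewrite ord1 ler_norml => xj1; apply/andP; split; nra.
rewrite (_ : [set _ | _] =
  (fun x : 'rV[R]_3 => \sum_i x 0 i ^+ 2) @^-1` [set 1])//.
apply: closed_comp => [x _|]; last exact: closed_eq.
apply: (@cvg_big _ _ _ _ _ _ _ (nbhs x)) => [|i _]; first exact: add_continuous.
by rewrite /= expr2; apply: cvgM; exact: coord_continuous.
Qed.

Lemma sphere2_norm (x : sphere2 R) : val x *m (val x)^T = 1%:M.
Proof.
have x1 : \sum_i (val x) 0 i ^+ 2 = 1 by exact: (set_valP x).
rewrite [LHS]mx11_scalar mxE; congr (_%:M); rewrite -[RHS]x1.
by apply: eq_bigr => i _; rewrite mxE expr2.
Qed.

Lemma sphere2_ex (x : 'rV[R]_3) :
  \sum_i x 0 i ^+ 2 = 1 -> exists s : sphere2 R, val s = x.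
Proof. by move=> x1; exists (exist _ x (mem_set x1)). Qed.

Definition star_point : 'rV[R]_4 := row_mx (1%:M : 'M[R]_1) (0 : 'rV[R]_3).

(** The rows are [star_point] and [x] placed in the last three coordinates. A line through the point
    meets the plane where the first coordinate vanishes in one point, that is, in two antipodal unit
    vectors; these induce opposite orientations. Hence oriented lines correspond to the sphere and
    lines to its antipodal quotient. *)
Definition star_frame (x : 'rV[R]_3) : 'M[R]_(2, 4) :=
  block_mx (1%:M : 'M[R]_1) 0 0 x.

Lemma row0_star_frame x : row 0 (star_frame x) = star_point.
Proof.
(* The block lemmas need 2 and 4 read as 1 + 1 and 1 + 3, hence the explicit dimensions here and
   below. *)
rewrite (_ : 0 = @lshift 1 1 0); last exact: val_inj.
exact: etrans (@rowKu R 1 1 (1 + 3) 0 (row_mx 1%:M 0) (row_mx 0 x)) (row_id 0 _).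
Qed.

Lemma row1_star_frame x : row 1 (star_frame x) = row_mx (0 : 'M[R]_1) x.
Proof.
rewrite (_ : 1 = @rshift 1 1 0); last exact: val_inj.
exact: etrans (@rowKd R 1 1 (1 + 3) 0 (row_mx 1%:M 0) (row_mx 0 x)) (row_id 0 _).
Qed.

Lemma star_frame_continuous : continuous star_frame.
Proof.
(* [P] and [Q] exhibit [star_frame] as an affine map built from matrix products, to which the limit
   lemmas apply. *)
pose P : 'M[R]_(2, 1) := col_mx (0 : 'M[R]_1) (1%:M : 'M[R]_1).
pose Q : 'M[R]_(3, 4) := row_mx (0 : 'M[R]_(3, 1)) 1%:M.
have -> : star_frame = (fun x => star_frame 0 + P *m x *m Q).
  apply/funext => x; rewrite /star_frame /P /Q (@mul_col_mx _ 1 1).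
  rewrite mul0mx mul1mx (@mul_col_mx _ 1 1) mul0mx (@mul_mx_row _ 1 3 1 3).
  rewrite mulmx0 mulmx1 -(@row_mx0 _ 1 1 3) (@add_block_mx _ 1 1 1 3).
  by rewrite !addr0 add0r.
move=> x; apply: (@cvgD _ _ _ (nbhs x)); first exact: cvg_cst.
apply: (@cvg_mulmx _ _ (nbhs x)); last exact: cvg_cst.
by apply: (@cvg_mulmx _ _ (nbhs x)); [exact: cvg_cst|exact: cvg_id].
Qed.

Lemma star_frame_free (x : sphere2 R) : row_free (star_frame (val x)).
Proof.
(* For a unit vector the rows are orthonormal, so the transpose is a right inverse. *)
apply/row_freeP; exists (star_frame (val x))^T.
rewrite /star_frame (@tr_block_mx _ 1 1 1 3) (@mulmx_block _ 1 1 1 3 1 1).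
rewrite !trmx0 trmx1 !mulmx0 !mul0mx !mulmx1 !addr0 add0r sphere2_norm.
by rewrite -scalar_mx_block.
Qed.

Lemma star_frame_scale (s : R) x :
  exists2 A : 'M[R]_2, \det A = s & star_frame (s *: x) = A *m star_frame x.
Proof.
exists (block_mx (1%:M : 'M[R]_1) 0 0 (s%:M : 'M[R]_1)).
  by rewrite (@det_ublock _ 1 1) det1 mul1r det_scalar1.
rewrite /star_frame (@mulmx_block _ 1 1 1 1 1 3) !mulmx0 !mul0mx !mulmx1.
by rewrite !addr0 add0r mul_scalar_mx.
Qed.

(** Comparing the first columns shows that [A] is upper triangular with upper left entry 1, so its
    lower right entry, which scales [x], is the determinant. *)
Lemma star_frame_change (A : 'M[R]_2) x y :
  star_frame y = A *m star_frame x -> y = \det A *: x.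
Proof.
rewrite -[A](@submxK _ 1 1 1 1) /star_frame (@mulmx_block _ 1 1 1 1 1 3).
rewrite !mulmx0 !mulmx1 !addr0 !add0r => /(@eq_block_mx _ 1 1 1 3)[<- _ <- ->].
rewrite (@det_ublock _ 1 1) det1 mul1r -mul_scalar_mx.
by rewrite {1}[drsubmx _]mx11_scalar det_mx11.
Qed.

Lemma star_point_mem (l : line R) x :
  line_frame l (star_frame x) -> star_point \in line_space l.
Proof.
move=> lx; rewrite (mem_line_frame _ lx).
by rewrite -(row0_star_frame x) row_sub.
Qed.

Lemma star_frame_ex (l : line R) : star_point \in line_space l ->
  exists x : sphere2 R, line_frame l (star_frame (val x)).
Proof.
move=> pl.
(* Take a vector of the line that is not a multiple of [star_point]. Removing its first coordinate
   keeps it on the line and leaves a nonzero [y], which can be normalized. *)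
have /subvPn[w wl wp] : ~~ (line_space l <= <[star_point]>)%VS.
  apply/negP => /dimvS; rewrite line_dim dim_vline.
  by case: (_ != _).
pose w0 := @lsubmx _ 1 1 3 w; pose y := @rsubmx _ 1 1 3 w.
have wE : w = row_mx w0 y by rewrite hsubmxK.
have y0 : y != 0.
  apply: contraNneq wp => y0; apply/vlineP; exists (w0 0 0).
  rewrite wE y0 /star_point (@scale_row_mx _ 1 1 3) scaler0.
  by rewrite {1}[w0]mx11_scalar scalemx1.
pose N := \sum_i y 0 i ^+ 2.
have N0 : 0 < N.
  rewrite lt_def sumr_ge0 ?andbT => [|i _]; last exact: sqr_ge0.
  apply: contra y0; rewrite psumr_eq0 => [/allP yi0|i _]; last exact: sqr_ge0.
  apply/eqP/rowP => i; rewrite [RHS]mxE; apply/eqP.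
  by rewrite -sqrf_eq0; apply: yi0; rewrite mem_index_enum.
have [|x xE] := @sphere2_ex ((Num.sqrt N)^-1 *: y).
  under eq_bigr do rewrite [(_ *: y) _ _]mxE exprMn exprVn sqr_sqrtr ?ltW//.
  by rewrite -mulr_sumr mulVf// gt_eqF.
exists x; apply: line_frameP => [|i]; first exact: star_frame_free.
rewrite xE; case: (ord2P i) => ->; first by rewrite row0_star_frame.
rewrite row1_star_frame.
have -> : (row_mx (0 : 'M[R]_1) ((Num.sqrt N)^-1 *: y) : 'rV[R]_4) =
    (Num.sqrt N)^-1 *: (w - w0 0 0 *: star_point).
  rewrite wE /star_point (@scale_row_mx _ 1 1 3) scaler0 scalemx1.
  rewrite -[_%:M](@mx11_scalar _ w0) (@opp_row_mx _ 1 1 3) (@add_row_mx _ 1 1 3).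
  by rewrite subrr oppr0 addr0 (@scale_row_mx _ 1 1 3) scaler0.
by rewrite memvZ// rpredB// memvZ.
Qed.

(** The unit vector found for the underlying line may induce the wrong orientation; its negative
    then induces the right one. *)
Lemma star_oframe_ex (o : oline R) : star_point \in line_space (forget o) ->
  exists x : sphere2 R, oline_frame o (star_frame (val x)).
Proof.
move=> /star_frame_ex[x ox]; have [B oB] := oline_frame_ex o.
have [A A0 xE] := line_frame_change oB.1 ox.
have [Ap|An] := ltP 0 (\det A).
  by exists x; rewrite xE; exact: oline_frameM.
have [|z zE] := @sphere2_ex (- val x).
  by under eq_bigr do rewrite mxE sqrrN; exact: (set_valP x).
exists z; rewrite zE -scaleN1r; have [D D1 ->] := star_frame_scale (- 1) (val x).
rewrite xE mulmxA; apply: oline_frameM oB _.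
by rewrite det_mulmx D1 mulN1r oppr_gt0 lt_neqAle A0.
Qed.

End sphere.

(** * Lines through the point and members of the parallelism *)

Section stars.
Variable R : realType.

Lemma pg_star_point : pg_points <[star_point R]>%VS.
Proof.
rewrite /pg_points /= dim_vline; suff -> : star_point R != 0 by [].
apply/eqP => /(congr1 (@lsubmx _ 1 1 3)); rewrite row_mxKl.
by move=> /matrixP/(_ 0 0); rewrite !mxE /= => /eqP; rewrite oner_eq0.
Qed.

Lemma compact_spread_star (C : set (line R)) : compact_spread C ->
  exists2 l, C l & star_point R \in line_space l.
Proof.
move=> [_ _ covC]; have : cover C (@points_on R) <[star_point R]>%VS.
  by rewrite covC; exact: pg_star_point.
by case=> l Cl [_ pl]; exists l; rewrite // -memvE.
Qed.

Lemma compact_spread_star_inj (C : set (line R)) l l' : compact_spread C ->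
  C l -> C l' -> star_point R \in line_space l ->
  star_point R \in line_space l' -> l = l'.
Proof.
move=> [_ tC _] Cl Cl' pl pl'; apply: tC => //; exists <[star_point R]>%VS.
by split; split; rewrite ?/points_on -?memvE//; exact: pg_star_point.
Qed.

(** The bijection [h] of [S] onto an ordinary spread carries existence, and in the next lemma
    uniqueness, over from that spread. *)
Lemma oriented_spread_star (S : set (oline R)) : oriented_spread S ->
  exists2 o, S o & star_point R \in line_space (forget o).
Proof.
move=> [C [S' [spC _ _ [h [[_ [g [_ _ gK]]] hE]] _]]].
have [l Cl pl] := compact_spread_star spC.
exists (set_val (g (exist _ l (mem_set Cl)))); first exact: set_valP.
by rewrite -hE gK.
Qed.

Lemma oriented_spread_star_inj (S : set (oline R)) o u : oriented_spread S ->
  S o -> S u -> star_point R \in line_space (forget o) ->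
  star_point R \in line_space (forget u) -> o = u.
Proof.
move=> [C [S' [spC _ _ [h [[_ [g [_ hK _]]] hE]] _]]] So Su po pu.
pose so : set_type S := exist _ o (mem_set So).
pose su : set_type S := exist _ u (mem_set Su).
suff /(can_inj hK)/(congr1 val) : h so = h su by [].
apply: val_inj; apply: (compact_spread_star_inj spC);
  [exact: set_valP|exact: set_valP|by rewrite hE|by rewrite hE].
Qed.

(** The change of frame scales one unit vector to the other by its determinant, whose square is
    therefore 1. For oriented lines, in [star_oframe_inj], the determinant is positive, which leaves
    only 1. *)
Lemma star_frame_antipodal (l : line R) (x y : sphere2 R) :
  line_frame l (star_frame (val x)) -> line_frame l (star_frame (val y)) ->
  antipodal x y.
Proof.
move=> lx ly; have [A _ /star_frame_change xE] := line_frame_change ly lx.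
have := sphere2_norm x; rewrite xE linearZ -scalemxAr -scalemxAl scalerA.
rewrite sphere2_norm => /matrixP/(_ 0 0); rewrite !mxE mulr1 -expr2.
move=> /eqP; rewrite sqrf_eq1 /antipodal xE => /orP[]/eqP->.
  by rewrite scale1r eqxx.
by rewrite scaleN1r eqxx orbT.
Qed.

Lemma antipodal_star_frame (l : line R) (x y : sphere2 R) : antipodal x y ->
  line_frame l (star_frame (val y)) -> line_frame l (star_frame (val x)).
Proof.
move=> /orP[]/eqP -> // ly; rewrite -scaleN1r.
have [A A1 ->] := star_frame_scale (- 1) (val y).
by apply: line_frameM; rewrite // A1 oppr_eq0 oner_eq0.
Qed.

Lemma star_oframe_inj (o : oline R) (x y : sphere2 R) :
  oline_frame o (star_frame (val x)) -> oline_frame o (star_frame (val y)) ->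
  x = y.
Proof.
move=> ox oy; have [A A0 /star_frame_change xE] := oline_frame_change oy ox.
apply: val_inj; have := sphere2_norm x.
rewrite xE linearZ -scalemxAr -scalemxAl scalerA.
rewrite sphere2_norm => /matrixP/(_ 0 0); rewrite !mxE mulr1 -expr2.
move=> /eqP; rewrite sqrf_eq1 => /orP[]/eqP dA; first by rewrite dA scale1r.
by move: A0; rewrite dA ltr0N1.
Qed.

Lemma sphere2_frame_continuous :
  continuous (fun x : sphere2 R => star_frame (val x)).
Proof.
have cv : continuous (val : sphere2 R -> 'rV[R]_3) by exact: initial_continuous.
by move=> x; exact: (cvg_comp _ _ (cv x) (@star_frame_continuous R (val x))).
Qed.

Lemma projective_plane_compact : compact [set: projective_plane R].
Proof.
have -> : [set: projective_plane R] =
    (\pi_(projective_plane R)%qT : sphere2 R -> _) @` setT.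
  by apply/seteqP; split => // q _; exists (repr q) => //; exact: reprK.
apply: continuous_compact; last exact: sphere2_compact.
exact/continuous_subspaceT/pi_continuous.
Qed.

Lemma topological_parallelism_projective_plane
    (Pi : set (hyperspace R (line R))) :
  topological_parallelism Pi -> homeomorphic (set_type Pi) (projective_plane R).
Proof.
move=> [spPi tPi covPi cPi]; apply: homeomorphic_sym.
pose ell (x : sphere2 R) := projT1 (cid (row_free_line (star_frame_free x))).
have ellP x : line_frame (ell x) (star_frame (val x)) by rewrite /ell; case: cid.
have cell : continuous ell.
  apply: (continuous_of_line_frame _ ellP).
  exact: sphere2_frame_continuous.
have [f cf fP] := continuous_selection (@line_hausdorff R) cPi tPi covPi cell.
have fE (K : set_type Pi) x : compact_set (val K) (ell x) -> f x = K.
  move=> Kx; apply: val_inj; apply: (tPi _ _ (set_valP _) (set_valP _)).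
  by exists (ell x); split => //; exact: fP.
have f_antipodal x y : antipodal x y -> f x = f y.
  move=> xy; apply: fE; suff -> : ell x = ell y by exact: fP.
  exact: line_frame_inj (ellP x) (antipodal_star_frame xy (ellP y)).
have repr_antipodal x : antipodal (repr (\pi_(projective_plane R)%qT x)) x.
  by apply/eqmodP; rewrite reprK.
(* Although [repr] need not be continuous, the composite is, because [f] is constant on antipodal
   pairs and so descends to the quotient. *)
exists (f \o repr); apply: compact_hausdorff_homeomorphism.
- exact: projective_plane_compact.
- exact/set_type_hausdorff/hyperspace_hausdorff/line_hausdorff.
- apply: repr_comp_continuous => // x y /eqP/eqmodP xy.
  by apply/eqP/f_antipodal.
(* Injectivity: two lines through the point in one spread coincide, so the unit vectors that span
   them with the point are antipodal or equal. *)
- move=> q q' /= ff; rewrite -[q]reprK -[q']reprK; apply/eqmodP.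
  have spC := spPi _ (set_valP (f (repr q))).
  apply: (star_frame_antipodal (ellP _)).
  suff -> : ell (repr q) = ell (repr q') by exact: ellP.
  apply: (compact_spread_star_inj spC); first exact: fP.
  + by rewrite ff; exact: fP.
  + exact: star_point_mem (ellP _).
  + exact: star_point_mem (ellP _).
- move=> K; have spK := spPi _ (set_valP K).
  have [l Kl /star_frame_ex[x lx]] := compact_spread_star spK.
  exists (\pi_(projective_plane R)%qT x) => /=.
  rewrite (f_antipodal _ _ (repr_antipodal x)).
  by apply: fE; rewrite (line_frame_inj (ellP x) lx).
Qed.

Lemma oriented_parallelism_sphere2 (Pi : set (hyperspace R (oline R))) :
  oriented_topological_parallelism Pi -> homeomorphic (set_type Pi) (sphere2 R).
Proof.
move=> [spPi tPi covPi cPi]; apply: homeomorphic_sym.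
pose ell (x : sphere2 R) := projT1 (cid (row_free_oline (star_frame_free x))).
have ellP x : oline_frame (ell x) (star_frame (val x)) by rewrite /ell; case: cid.
have cell : continuous ell.
  apply: (continuous_of_oline_frame _ ellP).
  exact: sphere2_frame_continuous.
have [f cf fP] := continuous_selection (@oline_hausdorff R) cPi tPi covPi cell.
exists f; apply: compact_hausdorff_homeomorphism => //.
- exact: sphere2_compact.
- exact/set_type_hausdorff/hyperspace_hausdorff/oline_hausdorff.
- move=> x y ff; apply: (star_oframe_inj (ellP x)).
  have spS := spPi _ (set_valP (f x)).
  suff -> : ell x = ell y by exact: ellP.
  apply: (oriented_spread_star_inj spS); first exact: fP.
  + by rewrite ff; exact: fP.
  + exact: star_point_mem (ellP _).1.
  + exact: star_point_mem (ellP _).1.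
- move=> K; have spK := spPi _ (set_valP K).
  have [u Ku /star_oframe_ex[x ux]] := oriented_spread_star spK.
  exists x; apply: val_inj; apply: (tPi _ _ (set_valP _) (set_valP _)).
  exists u; split => //; rewrite -(oline_frame_inj (ellP x) ux); exact: fP.
Qed.

End stars.

Theorem proposition2p3 (R : realType) :
  (forall Pi : set (hyperspace R (line R)),
     topological_parallelism Pi ->
     homeomorphic (set_type Pi) (projective_plane R)) /\
  (forall Pi : set (hyperspace R (oline R)),
     oriented_topological_parallelism Pi ->
     homeomorphic (set_type Pi) (sphere2 R)).
Proof.
split => Pi; first exact: topological_parallelism_projective_plane.
exact: oriented_parallelism_sphere2.
Qed.
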